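(* The problem Window is undecidable.
   Context: Temporal Datalog. Constants are partitioned into objects and integer time points; variables into object variables and time variables. A time term is a time point, a time variable, or an expression $t+k$ with $t$ a time variable and $k\in\mathbb{Z}$. Each predicate is either extensional (EDB) or intensional (IDB) and has an arity $n\ge0$, each position being of object sort or time sort; a predicate is rigid if all its positions are of object sort, and temporal if its last position is of time sort and all others are of object sort. An atom $P(t_1,\dots,t_n)$ has terms of the required sorts. A rule is $\bigwedge_i\alpha_i\to\alpha$ with $\alpha$ and all $\alpha_i$ rigid or temporal atoms, $\alpha$ IDB whenever the body is nonempty, and every head variable occurring in the body. A program is a finite set of rules. A fact is a ground rigid or temporal atom without $+$ (identified with the rule $\top\to\alpha$); a dataset is a finite set of EDB facts. Rules are read as universally quantified first-order sentences with $+$ interpreted as integer addition; $\Pi\models\alpha$ denotes entailment. A query is $Q=\langle P_Q,\Pi_Q\rangle$ with $\Pi_Q$ a program and $P_Q$ an IDB predicate of $\Pi_Q$; it is temporal if $P_Q$ is temporal. For a temporal query $Q$, dataset $D$ and time point $\tau$, $Q(D,\tau)$ is the set of tuples of objects $\vec o$ with $\Pi_Q\cup D\models P_Q(\vec o,\tau)$. For a dataset $D$ and time point $\tau$, $D[\tau]$ is the set of all rigid facts of $D$ together with the temporal facts of $D$ whose time argument is $>\tau$. A $\tau_{in}$-history is a dataset consisting of rigid facts and temporal facts with time argument $\le\tau_{in}$; a $\tau_{in}$-update is a dataset consisting of temporal facts with time argument $>\tau_{in}$. Window: an instance is $\langle Q,d,s\rangle$ with $Q$ a temporal query and $d,s$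 nonnegative integers; Window holds for it iff $Q(D\cup U,\tau_{out})=Q(D[\tau_{in}-s]\cup U,\tau_{out})$ for all time points $\tau_{in},\tau_{out}$ with $\tau_{out}>\tau_{in}-d$, every $\tau_{in}$-history $D$ and every $\tau_{in}$-update $U$. *)

(* Defs.v *)
From Stdlib Require Import ZArith List Arith.
Import ListNotations.
Set Implicit Arguments.

(* A predicate symbol.  Rules only contain rigid or temporal atoms, so every
   predicate occurring in a program is either rigid (p_oar object positions)
   or temporal (p_oar object positions followed by one time position). *)
Record pred := mkPred {
  p_id   : nat;
  p_idb  : bool;
  p_oar  : nat;
  p_temp : bool
}.

Inductive oterm := OVar (x : nat) | OConst (c : nat).

(* TVar x k is the time term  x + k  (TVar x 0 is the plain variable x). *)
Inductive tterm := TVar (x : nat) (k : Z) | TConst (t : Z).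

Record atom := mkAtom {
  a_pred : pred;
  a_objs : list oterm;
  a_time : option tterm
}.

Definition wf_atom (a : atom) : Prop :=
  length (a_objs a) = p_oar (a_pred a) /\
  (p_temp (a_pred a) = true <-> a_time a <> None).

Definition ovars (a : atom) : list nat :=
  flat_map (fun t => match t with OVar x => [x] | OConst _ => [] end) (a_objs a).

Definition tvars (a : atom) : list nat :=
  match a_time a with Some (TVar x _) => [x] | _ => [] end.

Record rule := mkRule { r_body : list atom; r_head : atom }.

Definition wf_rule (r : rule) : Prop :=
  wf_atom (r_head r) /\ (forall b, In b (r_body r) -> wf_atom b) /\
  (r_body r <> [] -> p_idb (a_pred (r_head r)) = true) /\
  (forall x, In x (ovars (r_head r)) -> exists b, In b (r_body r) /\ In x (ovars b)) /\
  (forall x, In x (tvars (r_head r)) -> exists b, In b (r_body r) /\ In x (tvars b)).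

Definition program := list rule.

Definition wf_program (P : program) : Prop := forall r, In r P -> wf_rule r.

Definition is_fact (a : atom) : Prop :=
  wf_atom a /\
  (forall t, In t (a_objs a) -> exists c, t = OConst c) /\
  (forall t, a_time a = Some t -> exists tau, t = TConst tau).

Definition is_edb_fact (a : atom) : Prop := is_fact a /\ p_idb (a_pred a) = false.

Definition dataset := list atom.
Definition is_dataset (D : dataset) : Prop := forall a, In a D -> is_edb_fact a.

Definition facts_as_rules (D : dataset) : program := map (fun a => mkRule [] a) D.

(* First-order semantics: the object sort is interpreted in an arbitrary
   (nonempty, since constants exist) domain, the time sort in Z with + as
   integer addition. *)

Section Semantics.
Variables (Dom : Type) (cst : nat -> Dom) (I : pred -> list Dom -> option Z -> Prop).
Variables (vo : nat -> Dom) (vt : nat -> Z).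

Definition eval_o (t : oterm) : Dom := match t with OVar x => vo x | OConst c => cst c end.
Definition eval_t (t : tterm) : Z := match t with TVar x k => (vt x + k)%Z | TConst tau => tau end.

Definition holds (a : atom) : Prop :=
  I (a_pred a) (map eval_o (a_objs a)) (option_map eval_t (a_time a)).
End Semantics.

Definition sat_rule (Dom : Type) (cst : nat -> Dom)
    (I : pred -> list Dom -> option Z -> Prop) (r : rule) : Prop :=
  forall vo vt, (forall b, In b (r_body r) -> holds cst I vo vt b) ->
                holds cst I vo vt (r_head r).

Definition entails (P : program) (alpha : atom) : Prop :=
  forall (Dom : Type) (cst : nat -> Dom) (I : pred -> list Dom -> option Z -> Prop),
    (forall r, In r P -> sat_rule cst I r) ->
    forall vo vt, holds cst I vo vt alpha.

Record query := mkQuery { q_pred : pred; q_prog : program }.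

Definition pred_of_program (p : pred) (P : program) : Prop :=
  exists r, In r P /\ (a_pred (r_head r) = p \/ exists b, In b (r_body r) /\ a_pred b = p).

Definition is_query (Q : query) : Prop :=
  wf_program (q_prog Q) /\ p_idb (q_pred Q) = true /\ pred_of_program (q_pred Q) (q_prog Q).

Definition is_temporal_query (Q : query) : Prop := is_query Q /\ p_temp (q_pred Q) = true.

Definition answer (Q : query) (D : dataset) (tau : Z) (o : list nat) : Prop :=
  length o = p_oar (q_pred Q) /\
  entails (facts_as_rules D ++ q_prog Q) (mkAtom (q_pred Q) (map OConst o) (Some (TConst tau))).

Definition keep_after (tau : Z) (a : atom) : bool :=
  match a_time a with
  | None => true
  | Some (TConst t) => Z.ltb tau t
  | Some (TVar _ _) => false
  end.

Definition restrict (D : dataset) (tau : Z) : dataset := filter (keep_after tau) D.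

Definition is_history (tau_in : Z) (D : dataset) : Prop :=
  is_dataset D /\
  forall a, In a D -> a_time a = None \/ exists t, a_time a = Some (TConst t) /\ (t <= tau_in)%Z.

Definition is_update (tau_in : Z) (U : dataset) : Prop :=
  is_dataset U /\
  forall a, In a U -> exists t, a_time a = Some (TConst t) /\ (tau_in < t)%Z.

Record instance := mkInstance { i_query : query; i_d : nat; i_s : nat }.

Definition is_instance (w : instance) : Prop := is_temporal_query (i_query w).

Definition Window (w : instance) : Prop :=
  forall tau_in tau_out : Z, (tau_out > tau_in - Z.of_nat (i_d w))%Z ->
  forall D U, is_history tau_in D -> is_update tau_in U ->
  forall o, answer (i_query w) (D ++ U) tau_out o <->
            answer (i_query w) (restrict D (tau_in - Z.of_nat (i_s w)) ++ U) tau_out o.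

Inductive recf :=
| RZero
| RSucc
| RProj (i : nat)
| RComp (f : recf) (gs : list recf)
| RPrim (f g : recf)
| RMu (f : recf).

Inductive reval : recf -> list nat -> nat -> Prop :=
| ev_zero args : reval RZero args 0
| ev_succ x args : reval RSucc (x :: args) (S x)
| ev_proj i args : i < length args -> reval (RProj i) args (nth i args 0)
| ev_comp f gs args ys y :
    reval_list gs args ys -> reval f ys y -> reval (RComp f gs) args y
| ev_prim0 f g args y : reval f args y -> reval (RPrim f g) (0 :: args) y
| ev_primS f g x args r y :
    reval (RPrim f g) (x :: args) r -> reval g (x :: r :: args) y ->
    reval (RPrim f g) (S x :: args) y
| ev_mu f args n :
    reval f (n :: args) 0 ->
    (forall m, m < n -> exists v, reval f (m :: args) (S v)) ->
    reval (RMu f) args n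
with reval_list : list recf -> list nat -> list nat -> Prop :=
| evl_nil args : reval_list [] args []
| evl_cons g gs args y ys :
    reval g args y -> reval_list gs args ys -> reval_list (g :: gs) args (y :: ys).

(* Standard (injective, computable) encoding of instances as naturals,
   via Cantor pairing. *)

Definition cpair (a b : nat) : nat := (a + b) * (a + b + 1) / 2 + b.
Definition enc_bool (b : bool) : nat := if b then 1 else 0.
Definition enc_Z (z : Z) : nat :=
  match z with
  | Z0 => 0
  | Zpos p => 2 * Pos.to_nat p
  | Zneg p => 2 * Pos.to_nat p - 1
  end.
Fixpoint enc_list A (e : A -> nat) (l : list A) : nat :=
  match l with [] => 0 | x :: l' => S (cpair (e x) (enc_list e l')) end.
Definition enc_option A (e : A -> nat) (o : option A) : nat :=
  match o with None => 0 | Some x => S (e x) end.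
Definition enc_pred (p : pred) : nat :=
  cpair (p_id p) (cpair (enc_bool (p_idb p)) (cpair (p_oar p) (enc_bool (p_temp p)))).
Definition enc_oterm (t : oterm) : nat :=
  match t with OVar x => cpair 0 x | OConst c => cpair 1 c end.
Definition enc_tterm (t : tterm) : nat :=
  match t with TVar x k => cpair 0 (cpair x (enc_Z k)) | TConst tau => cpair 1 (enc_Z tau) end.
Definition enc_atom (a : atom) : nat :=
  cpair (enc_pred (a_pred a)) (cpair (enc_list enc_oterm (a_objs a)) (enc_option enc_tterm (a_time a))).
Definition enc_rule (r : rule) : nat :=
  cpair (enc_list enc_atom (r_body r)) (enc_atom (r_head r)).
Definition enc_instance (w : instance) : nat :=
  cpair (cpair (enc_pred (q_pred (i_query w))) (enc_list enc_rule (q_prog (i_query w))))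
        (cpair (i_d w) (i_s w)).

Definition decidable_problem (P : instance -> Prop) : Prop :=
  exists f : recf, forall w, is_instance w ->
    (P w -> reval f [enc_instance w] 1) /\ (~ P w -> reval f [enc_instance w] 0).

(* Main.v *)
Require Import Defs.
From Stdlib Require Import ZArith List.
From Stdlib Require Import Lia Classical ClassicalEpsilon.
From Stdlib Require Cantor.
Import ListNotations.

(* A recursive function G is simulated on data objects by one rigid predicate per
   subterm.  Objects stand for numbers through a temporal predicate Lev, where
   Lev(x,t) says that x is reached from the zero object in t steps of an extensional
   successor relation; time arithmetic then replaces arithmetic on objects.  If some
   object has two levels, the goal holds everywhere.  Otherwise the levels give a
   homomorphism from the data to the natural numbers, so that the simulation only derives
   true values; conversely, a long enough chain of objects supports any terminating
   computation.  The goal also needs a temporal fact Tick, which a window can forget, so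
   Window fails for the program with input p iff G(p) = 1.
   The input p occurs only in one separate rule, so the code of the instance is a simple
   recursive function E of p and of the code of the other rules.  For a decider f, take
   G = f o E and let p be the code of the other rules: the program then computes the
   verdict of f on its own instance and does the opposite. *)

(** * Recursive functions are single-valued *)

(** [RComp] nests [recf] under [list]; the inner induction on that list yields a hypothesis for each
    component. *)
Lemma recf_nested_ind (P : recf -> Prop) :
  P RZero -> P RSucc -> (forall i, P (RProj i)) ->
  (forall f gs, P f -> Forall P gs -> P (RComp f gs)) ->
  (forall f g, P f -> P g -> P (RPrim f g)) ->
  (forall f, P f -> P (RMu f)) -> forall h, P h.
Proof.
  intros HZ HS HP HC HR HM.
  fix IH 1. intros [ | | i | f gs | f g | f].
  - exact HZ.
  - exact HS.
  - apply HP.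
  - apply HC; [apply IH|]. induction gs; constructor; [apply IH|assumption].
  - apply HR; apply IH.
  - apply HM; apply IH.
Qed.

Lemma reval_list_functional gs args :
  Forall (fun g => forall args y y', reval g args y -> reval g args y' -> y = y') gs ->
  forall ys ys', reval_list gs args ys -> reval_list gs args ys' -> ys = ys'.
Proof.
  induction 1; intros ys ys' H1 H2; inversion H1; inversion H2; subst; auto.
  f_equal; eauto.
Qed.

(** Two different results of a minimisation clash at the smaller one, where the function would be
    both zero and a successor. *)
Lemma reval_functional h : forall args y y',
  reval h args y -> reval h args y' -> y = y'.
Proof.
  induction h as [ | | i | f gs IHf IHgs | f g IHf IHg | f IHf] using recf_nested_ind;
    intros args y y' H1 H2.
  - inversion H1; inversion H2; congruence.
  - inversion H1; inversion H2; congruence.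
  - inversion H1; inversion H2; congruence.
  - inversion H1; inversion H2; subst.
    assert (ys = ys0) by (eapply reval_list_functional; eauto). subst; eauto.
  - assert (Hx : forall x args y y', reval (RPrim f g) (x :: args) y ->
                   reval (RPrim f g) (x :: args) y' -> y = y').
    { clear - IHf IHg.
      induction x; intros args y y' H1 H2; inversion H1; inversion H2; subst; eauto.
      assert (r = r0) by eauto. subst; eauto. }
    destruct args; [inversion H1|eauto].
  - inversion H1 as [ | | | | | | ? ? ? Hy Hlt];
      inversion H2 as [ | | | | | | ? ? ? Hy' Hlt']; subst.
    destruct (Nat.lt_trichotomy y y') as [H|[H|H]]; auto.
    + destruct (Hlt' _ H) as [v Hv]. discriminate (IHf _ _ _ Hy Hv).
    + destruct (Hlt _ H) as [v Hv]. discriminate (IHf _ _ _ Hy' Hv).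
Qed.

(** * Predicate symbols, their codes, and clauses over them *)

(** Predicates are named by numbers, so each function term needs a number of its own. *)
Fixpoint code_recf (h : recf) : nat :=
  match h with
  | RZero => Cantor.to_nat (0, 0)
  | RSucc => Cantor.to_nat (1, 0)
  | RProj i => Cantor.to_nat (2, i)
  | RComp f gs =>
      Cantor.to_nat (3, Cantor.to_nat (code_recf f,
        fold_right (fun g acc => S (Cantor.to_nat (code_recf g, acc))) 0 gs))
  | RPrim f g => Cantor.to_nat (4, Cantor.to_nat (code_recf f, code_recf g))
  | RMu f => Cantor.to_nat (5, code_recf f)
  end.

Lemma to_nat_inj a b c d : Cantor.to_nat (a, b) = Cantor.to_nat (c, d) -> a = c /\ b = d.
Proof. intros H. apply Cantor.to_nat_inj in H. now inversion H. Qed.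

Lemma code_recf_inj h : forall h', code_recf h = code_recf h' -> h = h'.
Proof.
  induction h as [ | | i | f gs IHf IHgs | f g IHf IHg | f IHf] using recf_nested_ind;
    intros [ | | i' | f' gs' | f' g' | f'] H; cbn [code_recf] in H;
    apply to_nat_inj in H; destruct H as [E H]; try discriminate E; try congruence.
  - apply to_nat_inj in H. destruct H as [Hf Hgs]. f_equal; auto.
    clear E Hf IHf. revert gs' Hgs.
    induction IHgs as [|g gs Hg _ IH]; intros [|g' gs'] Hgs; cbn [fold_right] in Hgs;
      try discriminate; auto.
    injection Hgs as Hgs. apply to_nat_inj in Hgs. destruct Hgs. f_equal; auto.
  - apply to_nat_inj in H. destruct H. f_equal; auto.
  - f_equal; auto.
Qed.

(* [Below h (n, args)]: the values of [h] at [(m, args)], [m < n], are defined and nonzero.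
   [On] is an intensional copy of the tick. *)
Inductive sym := Lev | Later | Goal | Inp | On | Ev (h : recf) | Below (h : recf).

Definition code_sym (s : sym) : nat :=
  Cantor.to_nat match s with
  | Lev => (0, 0) | Later => (1, 0) | Goal => (2, 0) | Inp => (3, 0) | On => (4, 0)
  | Ev h => (5, code_recf h) | Below h => (6, code_recf h)
  end.

Lemma code_sym_inj s s' : code_sym s = code_sym s' -> s = s'.
Proof.
  destruct s, s'; unfold code_sym; intros H; apply to_nat_inj in H; destruct H as [E H];
    try discriminate E; auto; f_equal; now apply code_recf_inj.
Qed.

Definition sym_pred (s : sym) (n : nat) (b : bool) : pred := mkPred (code_sym s) true n b.
(** [Lev] has the identifier 0 too; the flag [p_idb] keeps it apart from the extensional
    predicates. *)
Definition succ_pred : pred := mkPred 0 false 2 false.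
Definition tick_pred : pred := mkPred 0 false 0 true.

Definition is_some {A} (o : option A) : bool := match o with Some _ => true | None => false end.

(** Literals contain no object constants, so the truth of a clause does not depend on the
    interpretation of constants. *)
Record lit := Lit { l_sym : sym; l_vars : list nat; l_time : option tterm }.

Definition lit_atom (l : lit) : atom :=
  mkAtom (sym_pred (l_sym l) (length (l_vars l)) (is_some (l_time l)))
         (map OVar (l_vars l)) (l_time l).

Definition clause (body : list lit) (head : lit) : rule :=
  mkRule (map lit_atom body) (lit_atom head).

Definition ground (s : sym) (ns : list nat) (t : option Z) : atom :=
  mkAtom (sym_pred s (length ns) (is_some t)) (map OConst ns) (option_map TConst t).

Definition tvar (t : option tterm) : option nat :=
  match t with Some (TVar x _) => Some x | _ => None end.

Definition safe (body : list lit) (head : lit) : Prop :=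
  (forall x, In x (l_vars head) -> exists b, In b body /\ In x (l_vars b)) /\
  (forall x, tvar (l_time head) = Some x -> exists b, In b body /\ tvar (l_time b) = Some x).

Lemma wf_lit_atom l : wf_atom (lit_atom l).
Proof.
  split; cbn; [now rewrite length_map|].
  destruct (l_time l); cbn; split; congruence.
Qed.

Lemma ovars_lit_atom l : ovars (lit_atom l) = l_vars l.
Proof. unfold ovars; cbn. induction (l_vars l); cbn; congruence. Qed.

Lemma tvars_lit_atom l x : In x (tvars (lit_atom l)) <-> tvar (l_time l) = Some x.
Proof.
  unfold tvars; cbn. destruct (l_time l) as [[]|]; cbn; split; intuition congruence.
Qed.

Lemma wf_clause body head : safe body head -> wf_rule (clause body head).
Proof.
  intros [Hv Ht]. unfold wf_rule, clause; cbn [r_body r_head].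
  split; [apply wf_lit_atom|split; [|split; [auto|split]]].
  - intros b Hb. apply in_map_iff in Hb. destruct Hb as [l [<- _]]. apply wf_lit_atom.
  - intros x Hx. rewrite ovars_lit_atom in Hx. destruct (Hv x Hx) as [b [Hb Hxb]].
    exists (lit_atom b). rewrite ovars_lit_atom. split; auto. now apply in_map.
  - intros x Hx. apply tvars_lit_atom in Hx. destruct (Ht x Hx) as [b [Hb Hxb]].
    exists (lit_atom b). rewrite tvars_lit_atom. split; auto. now apply in_map.
Qed.

(** * The standard interpretation and soundness of clauses *)

(** The intended meaning over the natural numbers. [Goal] falls under the last case and is false,
    which makes this the source of countermodels. *)
Definition std (p : nat) (tick : Prop) (s : sym) (l : list nat) (t : option Z) : Prop :=
  match s, l, t with
  | Lev, [n], Some z => z = Z.of_nat n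
  | Later, [n], Some z => (Z.of_nat n < z)%Z
  | Inp, [], Some z => z = Z.of_nat p
  | On, [], Some _ => tick
  | Ev h, n :: ns, None => reval h ns n
  | Below h, n :: ns, None => forall m, m < n -> exists v, reval h (m :: ns) (S v)
  | _, _, _ => False
  end.

Definition lit_true p tick (vo : nat -> nat) (vt : nat -> Z) (l : lit) : Prop :=
  std p tick (l_sym l) (map vo (l_vars l)) (option_map (eval_t vt) (l_time l)).

Definition valid p tick (body : list lit) (head : lit) : Prop :=
  forall vo vt, (forall b, In b body -> lit_true p tick vo vt b) -> lit_true p tick vo vt head.

(* [None] is the value of the objects that are not reachable from the zero object. *)
Definition interp (p : nat) (tick : Prop) (q : pred) (l : list (option nat)) (t : option Z) : Prop :=
  if p_idb q then
    forall s, p_id q = code_sym s -> exists ns, l = map Some ns /\ std p tick s ns t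
  else
    (q = succ_pred -> forall a b n, l = [a; b] -> a = Some n -> b = Some (S n)) /\
    (q = tick_pred -> tick).

Lemma holds_lit_atom p tick cst vo vt l :
  holds cst (interp p tick) vo vt (lit_atom l) <->
  exists ns, map vo (l_vars l) = map Some ns /\
             std p tick (l_sym l) ns (option_map (eval_t vt) (l_time l)).
Proof.
  unfold holds, interp; cbn. rewrite map_map; cbn. split.
  - intros H. now apply H.
  - intros H s E. apply code_sym_inj in E. now subst.
Qed.

(** A true body literal forces its object variables to take values of the form [Some n], and safety
    passes this on to the head. Thus validity over the natural numbers survives the addition of
    [None]. *)
Lemma sat_clause p tick cst body head :
  safe body head -> valid p tick body head -> sat_rule cst (interp p tick) (clause body head).
Proof.
  intros [Hs _] Hv vo vt H. cbn in *.
  (* The default 0 is harmless: object variables of the head occur in the body, and no variable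
     there has the value [None]. *)
  set (env := fun x => match vo x with Some n => n | None => 0 end).
  assert (Hb : forall b, In b body -> lit_true p tick env vt b /\
                 forall x, In x (l_vars b) -> vo x = Some (env x)).
  { intros b Hb. apply (in_map lit_atom) in Hb. apply H in Hb.
    apply holds_lit_atom in Hb. destruct Hb as [ns [E Hb]].
    assert (Hx : forall x, In x (l_vars b) -> vo x = Some (env x)).
    { intros x Hx. apply (in_map vo) in Hx. rewrite E in Hx. apply in_map_iff in Hx.
      destruct Hx as [n [En _]]. unfold env. now rewrite <- En. }
    split; auto. unfold lit_true. replace (map env (l_vars b)) with ns; auto.
    rewrite <- (map_id ns).
    transitivity (map (fun o => match o with Some n => n | None => 0 end) (map Some ns)).
    - now rewrite map_map.
    - rewrite <- E, map_map. reflexivity. }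
  apply holds_lit_atom. exists (map env (l_vars head)). split.
  - rewrite map_map. apply map_ext_in. intros x Hx.
    destruct (Hs x Hx) as [b [Hb1 Hb2]]. now apply (Hb b).
  - apply Hv. intros b Hb1. now apply Hb.
Qed.

Definition sound_rule (r : rule) : Prop :=
  exists body head, r = clause body head /\ safe body head /\ forall p tick, valid p tick body head.

(** * Compilation of recursive functions into clauses, and its soundness *)

Definition ev (h : recf) (y : nat) (xs : list nat) : lit := Lit (Ev h) (y :: xs) None.
Definition below (h : recf) (y : nat) (xs : list nat) : lit := Lit (Below h) (y :: xs) None.
Definition lev (x : nat) (t : tterm) : lit := Lit Lev [x] (Some t).
(** Object variable [x] and time variable [x] are independent; these literals tie them, so that the
    time variable carries the number for which the object stands. They also bind head variables, as
    safety demands. *)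
Definition levs (xs : list nat) : list lit := map (fun x => lev x (TVar x 0)) xs.

(** One scheme for zero, successor and projection: the level of the result is a time term in the
    levels of the arguments. *)
Definition level_clause (h : recf) (n : nat) (t : tterm) : rule :=
  clause (lev 0 t :: levs (seq 4 n)) (ev h 0 (seq 4 n)).

(* Variables 4, ..., n+3 hold the arguments; the smaller ones are scratch variables. *)
Fixpoint compile (h : recf) (n : nat) : program :=
  let xs := seq 4 n in
  match h with
  | RZero => [level_clause h n (TConst 0)]
  | RSucc => if n =? 0 then [] else [level_clause h n (TVar 4 1)]
  | RProj i => if i <? n then [level_clause h n (TVar (4 + i) 0)] else []
  | RComp f gs =>
      let ys := seq (4 + n) (length gs) in
      clause (ev f 0 ys :: levs xs ++ map (fun gz => ev (fst gz) (snd gz) xs) (combine gs ys))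
             (ev h 0 xs)
      :: compile f (length gs) ++ flat_map (fun g => compile g n) gs
  | RPrim f g =>
      match n with
      | 0 => []
      | S m =>
          let xs := seq 4 m in
          clause [lev 1 (TConst 0); ev f 0 xs] (ev h 0 (1 :: xs))
          :: clause [lev 1 (TVar 1 0); lev 2 (TVar 1 1); ev h 3 (1 :: xs); ev g 0 (1 :: 3 :: xs)]
                    (ev h 0 (2 :: xs))
          :: compile f m ++ compile g (S (S m))
      end
  | RMu f =>
      clause [below f 0 xs; ev f 1 (0 :: xs); lev 1 (TConst 0)] (ev h 0 xs)
      :: clause (lev 0 (TConst 0) :: levs xs) (below f 0 xs)
      :: clause [below f 0 xs; lev 0 (TVar 0 0); lev 3 (TVar 0 1);
                 ev f 1 (0 :: xs); lev 2 (TVar 2 0); lev 1 (TVar 2 1)] (below f 3 xs)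
      :: compile f (S n)
  end.

Lemma levs_safe x xs : In x xs -> exists b, In b (levs xs) /\ In x (l_vars b).
Proof.
  intros H. exists (lev x (TVar x 0)). split; [|now left].
  now apply (in_map (fun x => lev x (TVar x 0))).
Qed.

Lemma levs_true p tick vo vt xs x :
  (forall b, In b (levs xs) -> lit_true p tick vo vt b) -> In x xs -> vt x = Z.of_nat (vo x).
Proof.
  intros H Hx. specialize (H _ (in_map (fun x => lev x (TVar x 0)) _ _ Hx)).
  unfold lit_true in H; cbn in H. lia.
Qed.

Lemma good_level_clause h n t :
  (forall vo vt, (forall x, In x (seq 4 n) -> vt x = Z.of_nat (vo x)) ->
     eval_t vt t = Z.of_nat (vo 0) -> reval h (map vo (seq 4 n)) (vo 0)) ->
  sound_rule (level_clause h n t).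
Proof.
  intros H. do 2 eexists. split; [reflexivity|split].
  - split; [|discriminate]. cbn. intros x [<-|Hx].
    + exists (lev 0 t). cbn. auto.
    + destruct (levs_safe _ _ Hx) as [b [Hb Hb']]. exists b; cbn; auto.
  - intros p tick vo vt Hb. unfold lit_true; cbn. apply (H vo vt).
    + intros x. apply (levs_true p tick). intros b Hl. apply Hb. now right.
    + apply (Hb (lev 0 t)). now left.
Qed.

(** Each clause mirrors a constructor of [reval] or extends [Below] by one number. [Below] avoids
    negation in minimisation: it collects positive evidence that all earlier values are
    successors. *)
Lemma compile_good h : forall n r, In r (compile h n) -> sound_rule r.
Proof.
  induction h as [ | | i | f gs IHf IHgs | f g IHf IHg | f IHf] using recf_nested_ind;
    intros n r Hr; cbn [compile] in Hr.
  - destruct Hr as [<-|[]]. apply good_level_clause. cbn. intros vo vt _ E.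
    replace (vo 0) with 0 by lia. constructor.
  - destruct n; cbn [Nat.eqb] in Hr; [destruct Hr|]. destruct Hr as [<-|[]].
    apply good_level_clause. intros vo vt H E. cbn in *.
    rewrite (H 4) in E by auto. replace (vo 0) with (S (vo 4)) by lia. constructor.
  - destruct (Nat.ltb_spec i n); [|destruct Hr]. destruct Hr as [<-|[]].
    apply good_level_clause. intros vo vt H' E. cbn [eval_t] in E.
    rewrite (H' (4 + i)) in E by (apply in_seq; lia).
    replace (vo 0) with (nth i (map vo (seq 4 n)) 0).
    + constructor. now rewrite length_map, length_seq.
    + rewrite nth_indep with (d' := vo 0) by now rewrite length_map, length_seq.
      rewrite map_nth, seq_nth by auto. lia.
  - destruct Hr as [<-|Hr].
    + do 2 eexists. split; [reflexivity|split].
      * split; [|discriminate]. cbn [ev l_vars]. intros x [<-|Hx].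
        { eexists. split; [now left|]. now left. }
        destruct (levs_safe _ _ Hx) as [b [Hb Hb']]. exists b. split; auto.
        right. apply in_or_app. auto.
      * intros p tick vo vt H. apply ev_comp with (ys := map vo (seq (4 + n) (length gs))).
        2: { exact (H _ (or_introl eq_refl)). }
        assert (H' : forall b, In b (map (fun gz => ev (fst gz) (snd gz) (seq 4 n))
                    (combine gs (seq (4 + n) (length gs)))) -> lit_true p tick vo vt b).
        { intros b Hb. apply H. right. apply in_or_app. auto. }
        (* The first variable for intermediate values must vary, since it moves by one with each
           function of the list. *)
        clear - H'. revert H'. generalize (4 + n).
        induction gs as [|g gs IH]; intros k H'; cbn; constructor.
        { exact (H' _ (or_introl eq_refl)). }
        apply IH. intros b Hb. apply H'. now right.
    + apply in_app_or in Hr. destruct Hr as [Hr|Hr]; [eauto|].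
      apply in_flat_map in Hr. destruct Hr as [g [Hg Hr]].
      rewrite Forall_forall in IHgs. eauto.
  - destruct n as [|m]; [destruct Hr|]. destruct Hr as [<-|[<-|Hr]].
    + do 2 eexists. split; [reflexivity|split].
      * split; [|discriminate]. cbn [ev l_vars]. intros x [<-|[<-|Hx]].
        { exists (ev f 0 (seq 4 m)). cbn; auto. }
        { exists (lev 1 (TConst 0)). cbn; auto. }
        { exists (ev f 0 (seq 4 m)). cbn; auto. }
      * intros p tick vo vt H.
        pose proof (H (lev 1 (TConst 0)) ltac:(cbn; auto)) as H1.
        pose proof (H (ev f 0 (seq 4 m)) ltac:(cbn; auto)) as H2.
        unfold lit_true in *; cbn in *. replace (vo 1) with 0 by lia. now constructor.
    + do 2 eexists. split; [reflexivity|split].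
      * split; [|discriminate]. cbn [ev l_vars]. intros x [<-|[<-|Hx]].
        { exists (ev g 0 (1 :: 3 :: seq 4 m)). cbn; tauto. }
        { exists (lev 2 (TVar 1 1)). cbn; auto. }
        { exists (ev g 0 (1 :: 3 :: seq 4 m)). cbn; auto 9. }
      * intros p tick vo vt H.
        pose proof (H (lev 1 (TVar 1 0)) ltac:(cbn; auto)) as H1.
        pose proof (H (lev 2 (TVar 1 1)) ltac:(cbn; auto)) as H2.
        pose proof (H (ev (RPrim f g) 3 (1 :: seq 4 m)) ltac:(cbn; auto)) as H3.
        pose proof (H (ev g 0 (1 :: 3 :: seq 4 m)) ltac:(cbn; auto)) as H4.
        unfold lit_true in *; cbn in *. replace (vo 2) with (S (vo 1)) by lia.
        econstructor; eauto.
    + apply in_app_or in Hr. destruct Hr; eauto.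
  - destruct Hr as [<-|[<-|[<-|Hr]]]; [| | |eauto].
    + do 2 eexists. split; [reflexivity|split].
      * split; [|discriminate]. intros x Hx. exists (below f 0 (seq 4 n)). cbn; auto.
      * intros p tick vo vt H.
        pose proof (H (below f 0 (seq 4 n)) ltac:(cbn; auto)) as H1.
        pose proof (H (ev f 1 (0 :: seq 4 n)) ltac:(cbn; auto)) as H2.
        pose proof (H (lev 1 (TConst 0)) ltac:(cbn; auto)) as H3.
        unfold lit_true in *; cbn in *. replace (vo 1) with 0 in * by lia. now constructor.
    + do 2 eexists. split; [reflexivity|split].
      * split; [|discriminate]. cbn [below l_vars]. intros x [<-|Hx].
        { exists (lev 0 (TConst 0)). cbn; auto. }
        destruct (levs_safe _ _ Hx) as [b [Hb Hb']]. exists b; cbn; auto.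
      * intros p tick vo vt H.
        pose proof (H (lev 0 (TConst 0)) ltac:(cbn; auto)) as H1.
        unfold lit_true in *; cbn in *. lia.
    + do 2 eexists. split; [reflexivity|split].
      * split; [|discriminate]. cbn [below l_vars]. intros x [<-|Hx].
        { exists (lev 3 (TVar 0 1)). cbn; auto. }
        exists (below f 0 (seq 4 n)). cbn; auto.
      * intros p tick vo vt H.
        pose proof (H (below f 0 (seq 4 n)) ltac:(cbn; auto)) as H1.
        pose proof (H (lev 0 (TVar 0 0)) ltac:(cbn; auto)) as H2.
        pose proof (H (lev 3 (TVar 0 1)) ltac:(cbn; auto)) as H3.
        pose proof (H (ev f 1 (0 :: seq 4 n)) ltac:(cbn; auto)) as H4.
        pose proof (H (lev 2 (TVar 2 0)) ltac:(cbn; auto 6)) as H5.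
        pose proof (H (lev 1 (TVar 2 1)) ltac:(cbn; auto 7)) as H6.
        unfold lit_true in *; cbn in *. intros m Hm.
        (* Only [vo 0] is new below the bound; the value there is [vo 1], one more than [vo 2] and
           hence nonzero. *)
        destruct (Nat.eq_dec m (vo 0)) as [->|]; [|apply H1; lia].
        exists (vo 2). replace (S (vo 2)) with (vo 1) by lia. assumption.
Qed.

(** * Forward chaining and completeness of the compilation *)

Definition lit_ground (env : nat -> nat) (vt : nat -> Z) (l : lit) : atom :=
  ground (l_sym l) (map env (l_vars l)) (option_map (eval_t vt) (l_time l)).

Lemma holds_lit_ground Dom (cst : nat -> Dom) I vo vt env vt' l :
  holds cst I vo vt (lit_ground env vt' l) =
  holds cst I (fun x => cst (env x)) vt' (lit_atom l).
Proof.
  unfold holds, lit_ground, ground; cbn. rewrite !map_map, length_map.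
  destruct (l_time l); reflexivity.
Qed.

Lemma entails_rule P r a env vt :
  In r P ->
  (forall b, In b (r_body r) ->
     exists b', entails P b' /\
       forall Dom (cst : nat -> Dom) I vo' vt', holds cst I vo' vt' b' ->
         holds cst I (fun x => cst (env x)) vt b) ->
  (forall Dom (cst : nat -> Dom) I vo' vt',
     holds cst I (fun x => cst (env x)) vt (r_head r) -> holds cst I vo' vt' a) ->
  entails P a.
Proof.
  intros Hr Hb Ha Dom cst I HI vo' vt'. apply Ha.
  apply (HI _ Hr). intros b Hin. destruct (Hb b Hin) as [b' [He Hi]].
  apply (Hi _ _ _ vo' vt'). now apply He.
Qed.

Lemma entails_clause P body head env vt :
  In (clause body head) P ->
  (forall l, In l body -> entails P (lit_ground env vt l)) ->
  entails P (lit_ground env vt head).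
Proof.
  intros Hr Hb. apply (entails_rule P _ _ env vt Hr).
  - cbn. intros b Hin. apply in_map_iff in Hin. destruct Hin as [l [<- Hl]].
    exists (lit_ground env vt l). split; auto.
    intros ? ? ? ? ?. now rewrite holds_lit_ground.
  - intros ? ? ? ? ?. now rewrite holds_lit_ground.
Qed.

Lemma entails_fact P a : In (mkRule [] a) P -> entails P a.
Proof. intros H Dom cst I HI vo vt. apply (HI _ H). intros b []. Qed.

(** Serves to replace assumed facts, such as [levels N], by a program that entails them. *)
Lemma entails_cut P P' a :
  (forall r, In r P -> In r P' \/ exists b, r = mkRule [] b /\ entails P' b) ->
  entails P a -> entails P' a.
Proof.
  intros H Ha Dom cst I HI. apply Ha. intros r Hr.
  destruct (H r Hr) as [Hr'|[b [-> Hb]]]; auto.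
  intros vo vt _. now apply Hb.
Qed.

Lemma entails_incl P P' a : incl P P' -> entails P a -> entails P' a.
Proof. intros H. apply entails_cut. auto. Qed.

Definition level (x n : nat) : atom := ground Lev [x] (Some (Z.of_nat n)).

Definition levels (N : nat) : program := map (fun n => mkRule [] (level n n)) (seq 0 (S N)).

(** A computation meets finitely many numbers, but they are not bounded by its input and output, so
    the bound is left existential. *)
Definition derivable (Rs : program) (a : atom) : Prop := exists N, entails (levels N ++ Rs) a.

Lemma entails_levels_le Rs N M a :
  N <= M -> entails (levels N ++ Rs) a -> entails (levels M ++ Rs) a.
Proof.
  intros H. apply entails_incl. apply incl_app_app; [|apply incl_refl].
  apply incl_map. intros n Hn. apply in_seq in Hn. apply in_seq. lia.
Qed.

Lemma derivable_clause Rs body head env vt :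
  In (clause body head) Rs ->
  (forall l, In l body -> derivable Rs (lit_ground env vt l)) ->
  derivable Rs (lit_ground env vt head).
Proof.
  intros Hr Hb.
  assert (HN : exists N, forall l, In l body -> entails (levels N ++ Rs) (lit_ground env vt l)).
  { clear Hr. induction body as [|l body IH]; [exists 0; intros ? []|].
    destruct IH as [N HN]; [intros; apply Hb; now right|].
    destruct (Hb l (or_introl eq_refl)) as [M HM]. exists (max N M).
    intros l' [<-|Hl'].
    - eapply entails_levels_le; [|exact HM]. lia.
    - eapply entails_levels_le; [|now apply HN]. lia. }
  destruct HN as [N HN]. exists N. eapply entails_clause; [|exact HN].
  apply in_or_app. auto.
Qed.

Lemma derivable_lev Rs env vt x t :
  eval_t vt t = Z.of_nat (env x) -> derivable Rs (lit_ground env vt (lev x t)).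
Proof.
  intros E. exists (env x). unfold lit_ground; cbn [lev l_sym l_vars l_time option_map map].
  rewrite E.
  apply entails_fact, in_or_app. left.
  apply (in_map (fun n => mkRule [] (level n n))). apply in_seq. lia.
Qed.

Lemma derivable_levs Rs env xs l :
  In l (levs xs) -> derivable Rs (lit_ground env (fun x => Z.of_nat (env x)) l).
Proof.
  intros H. apply in_map_iff in H. destruct H as [x [<- _]].
  apply derivable_lev. cbn. lia.
Qed.

Lemma map_nth_seq (pre l post : list nat) :
  map (fun i => nth i (pre ++ l ++ post) 0) (seq (length pre) (length l)) = l.
Proof.
  revert pre. induction l as [|x l IH]; intros pre; cbn; auto.
  f_equal.
  - rewrite app_nth2, Nat.sub_diag by lia; reflexivity.
  - specialize (IH (pre ++ [x])). rewrite length_app, Nat.add_1_r in IH.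
    rewrite <- IH at 2. apply map_ext. intros i. now rewrite <- app_assoc.
Qed.

(** The variable layout of [compile]: four scratch variables, the arguments, then the inner results
    of a composition. *)
Lemma env_exists a b c d args ys :
  exists env : nat -> nat, env 0 = a /\ env 1 = b /\ env 2 = c /\ env 3 = d /\
    map env (seq 4 (length args)) = args /\
    map env (seq (4 + length args) (length ys)) = ys.
Proof.
  exists (fun i => nth i ([a; b; c; d] ++ args ++ ys ++ []) 0).
  repeat split.
  - exact (map_nth_seq [a; b; c; d] args (ys ++ [])).
  - pose proof (map_nth_seq ([a; b; c; d] ++ args) ys []) as H.
    rewrite length_app in H. etransitivity; [|exact H].
    apply map_ext. intros i. now rewrite <- app_assoc.
Qed.

Lemma reval_list_length gs args ys : reval_list gs args ys -> length ys = length gs.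
Proof. revert ys. induction gs; intros ys H; inversion H; subst; cbn; auto. Qed.

Lemma derivable_level_clause Rs h args y t :
  In (level_clause h (length args) t) Rs ->
  (forall vt, (forall i, i < length args -> vt (4 + i) = Z.of_nat (nth i args 0)) ->
     eval_t vt t = Z.of_nat y) ->
  derivable Rs (ground (Ev h) (y :: args) None).
Proof.
  intros Hr Ht. destruct (env_exists y 0 0 0 args []) as [env [E0 [_ [_ [_ [Ea _]]]]]].
  assert (E : lit_ground env (fun x => Z.of_nat (env x)) (ev h 0 (seq 4 (length args)))
              = ground (Ev h) (y :: args) None).
  { unfold lit_ground; cbn -[seq]. now rewrite E0, Ea. }
  rewrite <- E. eapply derivable_clause; [exact Hr|].
  intros l [<-|Hl]; [|now apply derivable_levs with (xs := seq 4 (length args))].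
  apply derivable_lev. rewrite E0. apply Ht. intros i Hi. f_equal.
  rewrite <- Ea at 1. rewrite nth_indep with (d' := env 0) by now rewrite length_map, length_seq.
  now rewrite map_nth, seq_nth.
Qed.

(** The clauses are chained along the evaluation, with inner inductions on the list of a
    composition, the recursion argument, and the bound of a minimisation. *)
Lemma compile_complete h : forall Rs args y,
  reval h args y -> incl (compile h (length args)) Rs ->
  derivable Rs (ground (Ev h) (y :: args) None).
Proof.
  induction h as [ | | i | f gs IHf IHgs | f g IHf IHg | f IHf] using recf_nested_ind;
    intros Rs args y H Hi.
  - inversion H; subst. eapply derivable_level_clause; [apply Hi; now left|]. reflexivity.
  - inversion H; subst. eapply derivable_level_clause; [apply Hi; now left|].
    intros vt Hv. specialize (Hv 0). cbn in *. lia.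
  - inversion H as [ | | ? ? Hlt | | | | ]; subst.
    cbn [compile] in Hi. destruct (Nat.ltb_spec i (length args)); [|lia].
    eapply derivable_level_clause; [apply Hi; now left|].
    intros vt Hv. cbn [eval_t]. rewrite (Hv i) by auto. lia.
  - inversion H as [ | | | ? ? ? ys ? Hgs Hf | | | ]; subst.
    pose proof (reval_list_length _ _ _ Hgs) as Hlen.
    destruct (env_exists y 0 0 0 args ys) as [env [E0 [_ [_ [_ [Ea Ey]]]]]].
    assert (E : lit_ground env (fun x => Z.of_nat (env x)) (ev (RComp f gs) 0 (seq 4 (length args)))
                = ground (Ev (RComp f gs)) (y :: args) None).
    { unfold lit_ground; cbn -[seq]. now rewrite E0, Ea. }
    rewrite <- E. eapply derivable_clause; [apply Hi; now left|].
    intros l [<-|Hl]; [|apply in_app_or in Hl; destruct Hl as [Hl|Hl]].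
    + unfold lit_ground; cbn -[seq "+"]. rewrite E0, <- Hlen, Ey.
      apply IHf; auto. rewrite Hlen. intros r Hr. apply Hi. right. apply in_or_app. auto.
    + now apply derivable_levs with (xs := seq 4 (length args)).
    + assert (Hg : forall g, In g gs -> incl (compile g (length args)) Rs).
      { intros g Hg r Hr. apply Hi. right. apply in_or_app. right.
        apply in_flat_map. eauto. }
      clear - Hl Ea Ey IHgs Hgs Hg. revert ys Ey Hl Hgs. generalize (4 + length args).
      induction IHgs as [|g gs IHg _ IH]; intros k ys Ey Hl Hgs; [destruct Hl|].
      inversion Hgs; subst. cbn in Ey. injection Ey as E1 E2.
      destruct Hl as [<-|Hl].
      * unfold lit_ground; cbn -[seq]. rewrite E1, Ea. apply IHg; auto. apply Hg. now left.
      * eapply IH; eauto. intros g' Hg'. apply Hg. now right.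
  - destruct args as [|x args]; [inversion H|].
    assert (Hf : incl (compile f (length args)) Rs).
    { intros r Hr. apply Hi. right; right. apply in_or_app. auto. }
    assert (Hg : incl (compile g (S (S (length args)))) Rs).
    { intros r Hr. apply Hi. right; right. apply in_or_app. auto. }
    revert y H. induction x as [|x IHx]; intros y H.
    + inversion H; subst.
      destruct (env_exists y 0 0 0 args []) as [env [E0 [E1 [_ [_ [Ea _]]]]]].
      assert (E : lit_ground env (fun x => Z.of_nat (env x))
                    (ev (RPrim f g) 0 (1 :: seq 4 (length args)))
                  = ground (Ev (RPrim f g)) (y :: 0 :: args) None).
      { unfold lit_ground; cbn -[seq]. now rewrite E0, E1, Ea. }
      rewrite <- E. eapply derivable_clause; [apply Hi; now left|].
      intros l [<-|[<-|[]]].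
      * apply derivable_lev. now rewrite E1.
      * unfold lit_ground; cbn -[seq]. rewrite E0, Ea. auto.
    + inversion H as [ | | | | | ? ? ? ? r ? Hr Hy | ]; subst.
      destruct (env_exists y x (S x) r args []) as [env [E0 [E1 [E2 [E3 [Ea _]]]]]].
      assert (E : lit_ground env (fun x => Z.of_nat (env x))
                    (ev (RPrim f g) 0 (2 :: seq 4 (length args)))
                  = ground (Ev (RPrim f g)) (y :: S x :: args) None).
      { unfold lit_ground; cbn -[seq]. now rewrite E0, E2, Ea. }
      rewrite <- E. eapply derivable_clause; [apply Hi; right; now left|].
      intros l [<-|[<-|[<-|[<-|[]]]]].
      * apply derivable_lev. cbn. lia.
      * apply derivable_lev. cbn -[Z.of_nat]. lia.
      * unfold lit_ground; cbn -[seq]. rewrite E3, E1, Ea. apply IHx; auto.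
      * unfold lit_ground; cbn -[seq]. rewrite E0, E1, E3, Ea. apply IHg; auto.
  - inversion H as [ | | | | | | ? ? ? H0 Hlt]; subst.
    assert (Hf : incl (compile f (S (length args))) Rs).
    { intros r Hr. apply Hi. right; right; right. auto. }
    assert (Hb : forall k, (forall m, m < k -> exists v, reval f (m :: args) (S v)) ->
                   derivable Rs (ground (Below f) (k :: args) None)).
    { induction k as [|k IHk]; intros Hk.
      - destruct (env_exists 0 0 0 0 args []) as [env [E0 [_ [_ [_ [Ea _]]]]]].
        assert (E : lit_ground env (fun x => Z.of_nat (env x)) (below f 0 (seq 4 (length args)))
                    = ground (Below f) (0 :: args) None).
        { unfold lit_ground; cbn -[seq]. now rewrite E0, Ea. }
        rewrite <- E. eapply derivable_clause; [apply Hi; right; now left|].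
        intros l [<-|Hl]; [|now apply derivable_levs with (xs := seq 4 (length args))].
        apply derivable_lev. now rewrite E0.
      - destruct (Hk k) as [v Hv]; [lia|].
        (* Scratch variable 2 denotes the predecessor [v] of the value, which certifies that the
           value is nonzero. *)
        destruct (env_exists k (S v) v (S k) args []) as [env [E0 [E1 [E2 [E3 [Ea _]]]]]].
        assert (E : lit_ground env (fun x => Z.of_nat (env x)) (below f 3 (seq 4 (length args)))
                    = ground (Below f) (S k :: args) None).
        { unfold lit_ground; cbn -[seq]. now rewrite E3, Ea. }
        rewrite <- E. eapply derivable_clause; [apply Hi; right; right; now left|].
        intros l [<-|[<-|[<-|[<-|[<-|[<-|[]]]]]]].
        + unfold lit_ground; cbn -[seq]. rewrite E0, Ea. apply IHk. intros m Hm. apply Hk. lia.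
        + apply derivable_lev. cbn. lia.
        + apply derivable_lev. cbn -[Z.of_nat]. lia.
        + unfold lit_ground; cbn -[seq]. rewrite E0, E1, Ea. apply IHf; auto.
        + apply derivable_lev. cbn. lia.
        + apply derivable_lev. cbn -[Z.of_nat]. lia. }
    destruct (env_exists y 0 0 0 args []) as [env [E0 [E1 [_ [_ [Ea _]]]]]].
    assert (E : lit_ground env (fun x => Z.of_nat (env x)) (ev (RMu f) 0 (seq 4 (length args)))
                = ground (Ev (RMu f)) (y :: args) None).
    { unfold lit_ground; cbn -[seq]. now rewrite E0, Ea. }
    rewrite <- E. eapply derivable_clause; [apply Hi; now left|].
    intros l [<-|[<-|[<-|[]]]].
    + unfold lit_ground; cbn -[seq]. rewrite E0, Ea. auto.
    + unfold lit_ground; cbn -[seq]. rewrite E0, E1, Ea. apply IHf; auto.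
    + apply derivable_lev. now rewrite E1.
Qed.

(** * The program for an input, and its well-formedness *)

Definition succ_fact (a b : nat) : atom := mkAtom succ_pred [OConst a; OConst b] None.

Definition later (x : nat) (t : tterm) : lit := Lit Later [x] (Some t).
Definition at_time (s : sym) (t : tterm) : lit := Lit s [] (Some t).

(** Rules have no inequality, so a second level is detected through [Later], which spreads from a
    level to all greater times. The last two clauses carry [Goal] from time 0 to every integer. *)
Definition level_clauses : program :=
  [clause [lev 0 (TVar 0 0)] (later 0 (TVar 0 1));
   clause [later 0 (TVar 0 0)] (later 0 (TVar 0 1));
   clause [lev 0 (TVar 0 0); later 0 (TVar 0 0)] (at_time Goal (TConst 0));
   clause [at_time Goal (TVar 0 0)] (at_time Goal (TVar 0 1));
   clause [at_time Goal (TVar 0 0)] (at_time Goal (TVar 0 (-1)))].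

(** No object is named: the input is found as an object whose level is the time of [Inp], and the
    result 1 is recognised by its level. *)
Definition accept_body (G : recf) : list lit :=
  [at_time On (TVar 0 0); at_time Inp (TVar 1 0); lev 1 (TVar 1 0);
   ev G 0 [1]; lev 0 (TConst 1)].

Definition accept_clause (G : recf) : rule := clause (accept_body G) (at_time Goal (TConst 0)).

(** Only these rules mention a data predicate or an object constant, so they are not written as
    clauses. *)
Definition edb_rules : program :=
  [mkRule [] (level 0 0);
   mkRule [lit_atom (lev 0 (TVar 0 0)); mkAtom succ_pred [OVar 0; OVar 1] None]
          (lit_atom (lev 1 (TVar 0 1)));
   mkRule [mkAtom tick_pred [] (Some (TVar 0 0))] (lit_atom (at_time On (TVar 0 0)))].

Definition simulation (G : recf) : program :=
  edb_rules ++ level_clauses ++ accept_clause G :: compile G 1.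

Definition input_rule (p : nat) : rule := mkRule [] (ground Inp [] (Some (Z.of_nat p))).

Definition window_program (G : recf) (p : nat) : program := input_rule p :: simulation G.

Definition window_instance (G : recf) (p : nat) : instance :=
  mkInstance (mkQuery (sym_pred Goal 0 true) (window_program G p)) 0 0.

(** The clause deriving [Goal] from two levels is vacuously valid: [std] puts [Lev] at time [n] only
    and [Later] strictly after [n]. *)
Lemma level_clauses_good r : In r level_clauses -> sound_rule r.
Proof.
  intros [<-|[<-|[<-|[<-|[<-|[]]]]]]; do 2 eexists;
    (split; [reflexivity|split; [split|]]); cbn;
    try (now intros x []); try discriminate;
    try (intros x Hx; eexists; split; [now left|]; exact Hx);
    intros p tick vo vt H.
  - pose proof (H _ (or_introl eq_refl)) as H0. unfold lit_true in *; cbn in *. lia.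
  - pose proof (H _ (or_introl eq_refl)) as H0. unfold lit_true in *; cbn in *. lia.
  - pose proof (H _ (or_introl eq_refl)) as H0.
    pose proof (H _ (or_intror (or_introl eq_refl))) as H1. unfold lit_true in *; cbn in *. lia.
  - exact (H _ (or_introl eq_refl)).
  - exact (H _ (or_introl eq_refl)).
Qed.

Lemma accept_clause_safe G : safe (accept_body G) (at_time Goal (TConst 0)).
Proof. split; [intros x []|discriminate]. Qed.

Lemma sat_accept_clause p tick cst G :
  ~ (tick /\ reval G [p] 1) -> sat_rule cst (interp p tick) (accept_clause G).
Proof.
  intros Hn. apply sat_clause; [apply accept_clause_safe|].
  intros vo vt H. apply Hn.
  pose proof (H (at_time On (TVar 0 0)) ltac:(cbn; tauto)) as H0.
  pose proof (H (at_time Inp (TVar 1 0)) ltac:(cbn; tauto)) as H1.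
  pose proof (H (lev 1 (TVar 1 0)) ltac:(cbn; tauto)) as H2.
  pose proof (H (ev G 0 [1]) ltac:(cbn; tauto)) as H3.
  pose proof (H (lev 0 (TConst 1)) ltac:(cbn; tauto)) as H4.
  unfold lit_true in *; cbn in *.
  replace (vo 1) with p in H3 by lia. replace (vo 0) with 1 in H3 by lia. auto.
Qed.

Lemma simulation_wf G : wf_program (simulation G).
Proof.
  intros r Hr. unfold simulation in Hr.
  apply in_app_or in Hr. destruct Hr as [Hr|Hr].
  - destruct Hr as [<-|[<-|[<-|[]]]].
    + repeat split; cbn; try tauto; discriminate.
    + split; [apply wf_lit_atom|]. split; [|split; [reflexivity|split]].
      * intros b [<-|[<-|[]]]; [apply wf_lit_atom|].
        repeat split; cbn; congruence.
      * intros x [<-|[]]. eexists. split; [right; now left|]. cbn; auto.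
      * intros x [<-|[]]. eexists. split; [now left|]. cbn; auto.
    + split; [apply wf_lit_atom|]. split; [|split; [reflexivity|split]].
      * intros b [<-|[]]. repeat split; cbn; congruence.
      * intros x [].
      * intros x [<-|[]]. eexists. split; [now left|]. cbn; auto.
  - apply in_app_or in Hr. destruct Hr as [Hr|[<-|Hr]].
    + destruct (level_clauses_good r Hr) as [b [h [-> [Hs _]]]]. now apply wf_clause.
    + apply wf_clause, accept_clause_safe.
    + destruct (compile_good _ _ _ Hr) as [b [h [-> [Hs _]]]]. now apply wf_clause.
Qed.

Lemma window_instance_is_instance G p : is_instance (window_instance G p).
Proof.
  split; [split; [|split]|]; try reflexivity.
  - intros r [<-|Hr]; [|now apply (simulation_wf G)].
    repeat split; cbn; try tauto; discriminate.
  - exists (accept_clause G). split; [|now left].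
    right. apply in_or_app. right. apply in_or_app. right. now left.
Qed.

(** * Countermodels from homomorphisms into the natural numbers *)

Lemma edb_succ_fact a :
  is_edb_fact a -> a_pred a = succ_pred -> exists x y, a = succ_fact x y.
Proof.
  intros [[[Hl Ht] [Hc _]] _] E. destruct a as [q l t]; cbn in *. subst q; cbn in *.
  destruct t; [destruct Ht as [_ Ht]; discriminate Ht; discriminate|].
  destruct l as [|u [|v [|]]]; try discriminate Hl.
  destruct (Hc u) as [x ->]; [now left|]. destruct (Hc v) as [y ->]; [right; now left|].
  now exists x, y.
Qed.

(** The partial homomorphism [cst] makes [interp] a model of data and rules in which [Goal] is
    false. Keeping [tick] a parameter covers data with and without a tick. *)
Lemma goal_not_entailed G p tick cst D tau :
  ~ (tick /\ reval G [p] 1) -> is_dataset D -> cst 0 = Some 0 ->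
  (forall a b n, In (succ_fact a b) D -> cst a = Some n -> cst b = Some (S n)) ->
  (forall a, In a D -> a_pred a = tick_pred -> tick) ->
  ~ entails (facts_as_rules D ++ window_program G p) (ground Goal [] (Some tau)).
Proof.
  intros Hn HD H0 HS HT He.
  assert (HG : ~ forall vo vt, holds cst (interp p tick) vo vt (ground Goal [] (Some tau))).
  { intros H. destruct (H (fun _ => None) (fun _ => 0%Z) Goal eq_refl) as [ns [_ Hs]].
    destruct ns; exact Hs. }
  apply HG, He. intros r Hr. apply in_app_or in Hr. destruct Hr as [Hr|[<-|Hr]].
  (* Extensional predicates other than successor and tick are true everywhere in [interp]. *)
  - apply in_map_iff in Hr. destruct Hr as [a [<- Ha]]. intros vo vt _. cbn.
    pose proof (HD a Ha) as Hf. unfold holds, interp. rewrite (proj2 Hf). split.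
    + intros E u v n El Eu. destruct (edb_succ_fact a Hf E) as [x [y ->]].
      cbn in El. injection El as <- <-. eauto.
    + eauto.
  - intros vo vt _ s E. apply (code_sym_inj Inp) in E. subst s. exists []. split; reflexivity.
  - unfold simulation in Hr. apply in_app_or in Hr. destruct Hr as [Hr|Hr].
    + destruct Hr as [<-|[<-|[<-|[]]]]; intros vo vt Hb.
      * intros s E. apply (code_sym_inj Lev) in E. subst s. exists [0]. cbn. now rewrite H0.
      * pose proof (Hb _ (or_introl eq_refl)) as H1. apply holds_lit_atom in H1.
        destruct H1 as [ns [E H1]]. destruct ns as [|n [|]]; try discriminate E.
        injection E as E. cbn in H1.
        pose proof (Hb _ (or_intror (or_introl eq_refl))) as [H2 _].
        specialize (H2 eq_refl _ _ _ eq_refl E). cbn in H2.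
        apply holds_lit_atom. exists [S n]. cbn -[Z.of_nat]. rewrite H2. split; auto. lia.
      * pose proof (Hb _ (or_introl eq_refl)) as [_ H2].
        apply holds_lit_atom. exists []. split; auto. exact (H2 eq_refl).
    + apply in_app_or in Hr. destruct Hr as [Hr|[<-|Hr]].
      * destruct (level_clauses_good r Hr) as [b [h [-> [Hs Hv]]]]. now apply sat_clause.
      * now apply sat_accept_clause.
      * destruct (compile_good _ _ _ Hr) as [b [h [-> [Hs Hv]]]]. now apply sat_clause.
Qed.

(** * Levels of objects and entailment of the goal *)

Lemma goal_everywhere P :
  incl level_clauses P -> entails P (ground Goal [] (Some 0%Z)) ->
  forall tau, entails P (ground Goal [] (Some tau)).
Proof.
  intros Hi H0.
  assert (Hstep : forall d z, In (clause [at_time Goal (TVar 0 0)] (at_time Goal (TVar 0 d))) P ->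
            entails P (ground Goal [] (Some z)) -> entails P (ground Goal [] (Some (z + d)%Z))).
  { intros d z Hr Hz.
    apply (entails_clause P _ _ (fun _ => 0) (fun _ => z) Hr).
    intros l [<-|[]]. unfold lit_ground; cbn. now rewrite Z.add_0_r. }
  assert (Hnat : forall n, entails P (ground Goal [] (Some (Z.of_nat n))) /\
                           entails P (ground Goal [] (Some (- Z.of_nat n)%Z))).
  { induction n as [|n [IH1 IH2]]; [split; exact H0|]. split.
    - replace (Z.of_nat (S n)) with (Z.of_nat n + 1)%Z by lia.
      apply Hstep; auto. apply Hi. cbn; tauto.
    - replace (- Z.of_nat (S n))%Z with (- Z.of_nat n + -1)%Z by lia.
      apply Hstep; auto. apply Hi. cbn; tauto. }
  intros tau. destruct (Z.le_ge_cases 0 tau).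
  - replace tau with (Z.of_nat (Z.to_nat tau)) by lia. apply Hnat.
  - replace tau with (- Z.of_nat (Z.to_nat (- tau)))%Z by lia. apply Hnat.
Qed.

Inductive reach (D : dataset) : nat -> nat -> Prop :=
| reach_zero : reach D 0 0
| reach_succ a b n : reach D a n -> In (succ_fact a b) D -> reach D b (S n).

Lemma reach_entails D G p x n :
  reach D x n -> entails (facts_as_rules D ++ window_program G p) (level x n).
Proof.
  induction 1 as [|a b n _ IH Hab].
  - apply entails_fact, in_or_app. right; right; now left.
  - eapply (entails_rule _ _ _ (fun i => match i with 0 => a | _ => b end) (fun _ => Z.of_nat n)).
    + apply in_or_app. right; right; right; now left.
    + intros q [<-|[<-|[]]].
      * exists (level a n). split; auto. intros. unfold holds in *; cbn in *.
        now rewrite Z.add_0_r.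
      * exists (succ_fact a b). split; auto.
        apply entails_fact, in_or_app. left.
        apply (in_map (fun a => mkRule [] a) _ _ Hab).
    + intros Dom cst I vo' vt' H. unfold holds in *; cbn -[Z.of_nat] in *.
      now replace (Z.of_nat (S n)) with (Z.of_nat n + 1)%Z by lia.
Qed.

Lemma level_clauses_incl D G p :
  incl level_clauses (facts_as_rules D ++ window_program G p).
Proof.
  intros r Hr. apply in_or_app. right; right. apply in_or_app. right. apply in_or_app. now left.
Qed.

(** From level [n], [Later] reaches every time after [n], and at [m] it meets the second level. *)
Lemma two_levels_goal D G p x n m tau :
  reach D x n -> reach D x m -> n < m ->
  entails (facts_as_rules D ++ window_program G p) (ground Goal [] (Some tau)).
Proof.
  intros Hn Hm Hlt. apply (reach_entails D G p) in Hn, Hm.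
  pose proof (level_clauses_incl D G p) as Hi. revert Hn Hm Hi.
  generalize (facts_as_rules D ++ window_program G p) as P. intros P Hn Hm Hi.
  assert (HL : forall k, entails P (ground Later [x] (Some (Z.of_nat n + 1 + Z.of_nat k)%Z))).
  { assert (Hstep : forall s z, In (clause [Lit s [0] (Some (TVar 0 0))] (later 0 (TVar 0 1))) P ->
      entails P (ground s [x] (Some z)) -> entails P (ground Later [x] (Some (z + 1)%Z))).
    { intros s z Hr Hz. apply (entails_clause P _ _ (fun _ => x) (fun _ => z) Hr).
      intros l [<-|[]]. unfold lit_ground; cbn. now rewrite Z.add_0_r. }
    induction k as [|k IH].
    - rewrite Z.add_0_r. apply (Hstep Lev); auto. apply Hi. cbn; tauto.
    - replace (Z.of_nat n + 1 + Z.of_nat (S k))%Z with (Z.of_nat n + 1 + Z.of_nat k + 1)%Z by lia.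
      apply (Hstep Later); auto. apply Hi. cbn; tauto. }
  apply goal_everywhere; auto.
  apply (entails_clause P [lev 0 (TVar 0 0); later 0 (TVar 0 0)] (at_time Goal (TConst 0))
           (fun _ => x) (fun _ => Z.of_nat m)).
  - apply Hi. cbn; tauto.
  - intros l [<-|[<-|[]]]; unfold lit_ground; cbn; rewrite Z.add_0_r; auto.
    replace (Z.of_nat m) with (Z.of_nat n + 1 + Z.of_nat (m - n - 1))%Z by lia. auto.
Qed.

(** If levels are unique, the level is itself the homomorphism, with [None] on unreachable objects.
    Taken from [D], it also serves the subset [D']; [tick] may be [True] because [G] does not return
    1. *)
Lemma one_level_no_goal D G p D' tau :
  is_dataset D -> incl D' D -> ~ reval G [p] 1 ->
  (forall x n m, reach D x n -> reach D x m -> ~ n < m) ->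
  ~ entails (facts_as_rules D' ++ window_program G p) (ground Goal [] (Some tau)).
Proof.
  intros HD Hi HG HR.
  set (cst := fun x => match excluded_middle_informative (exists n, reach D x n) with
                       | left H => Some (proj1_sig (constructive_indefinite_description _ H))
                       | right _ => None
                       end).
  assert (Hc : forall x n, cst x = Some n <-> reach D x n).
  { intros x n. unfold cst. destruct excluded_middle_informative as [H|H].
    - destruct constructive_indefinite_description as [m Hm]; cbn. split.
      + now intros [= <-].
      + intros Hn. f_equal. pose proof (HR _ _ _ Hn Hm). pose proof (HR _ _ _ Hm Hn). lia.
    - split; [discriminate|]. intros Hn. destruct H. eauto. }
  apply (goal_not_entailed G p True cst).
  - tauto.
  - intros a Ha. auto.
  - apply Hc. constructor.
  - intros a b n Hab Ha. apply Hc. apply Hc in Ha. econstructor; eauto.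
  - auto.
Qed.

Lemma goal_answer G p D tau o :
  answer (i_query (window_instance G p)) D tau o <->
  o = [] /\ entails (facts_as_rules D ++ window_program G p) (ground Goal [] (Some tau)).
Proof.
  unfold answer; cbn [i_query window_instance q_pred q_prog sym_pred p_oar]. split.
  - intros [Hl H]. destruct o; [auto|discriminate].
  - intros [-> H]. auto.
Qed.

(** * The window property expresses the value of the function *)

(** Both datasets give the same answers: the goal is entailed at every time if some object has two
    levels, and at none otherwise. *)
Lemma window_holds G p : ~ reval G [p] 1 -> Window (window_instance G p).
Proof.
  intros HG tin tout _ D U [HD _] [HU _] o. rewrite !goal_answer.
  set (D' := restrict D _ ++ U).
  assert (HDU : is_dataset (D ++ U)).
  { intros a Ha. apply in_app_or in Ha. destruct Ha; auto. }
  assert (Hi : incl D' (D ++ U)).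
  { apply incl_app_app; [apply incl_filter|apply incl_refl]. }
  (* Successor facts are rigid and survive the restriction. *)
  assert (Hr : forall x n, reach (D ++ U) x n -> reach D' x n).
  { induction 1 as [|a b n _ IH Hab]; [constructor|]. apply (reach_succ _ a); auto.
    apply in_or_app. apply in_app_or in Hab. destruct Hab; [left|now right].
    apply filter_In. auto. }
  destruct (classic (exists x n m, reach (D ++ U) x n /\ reach (D ++ U) x m /\ n < m))
    as [[x [n [m [Hn [Hm Hlt]]]]]|HR].
  - split; intros [-> _]; split; auto; apply two_levels_goal with (x := x) (n := n) (m := m); auto.
  - assert (HR' : forall x n m, reach (D ++ U) x n -> reach (D ++ U) x m -> ~ n < m).
    { intros x n m Hn Hm Hlt. apply HR. eauto 10. }
    split; intros [_ He]; exfalso; revert He; apply (one_level_no_goal (D ++ U)); auto.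
    apply incl_refl.
Qed.

Definition chain (N : nat) : dataset :=
  mkAtom tick_pred [] (Some (TConst 0)) :: map (fun n => succ_fact n (S n)) (seq 0 N).

Lemma chain_reach N n : n <= N -> reach (chain N) n n.
Proof.
  induction n as [|n IH]; intros H; [constructor|].
  apply (reach_succ _ n); [apply IH; lia|]. right.
  apply (in_map (fun n => succ_fact n (S n))). apply in_seq. lia.
Qed.

Lemma chain_goal G p :
  reval G [p] 1 ->
  exists N, forall tau,
    entails (facts_as_rules (chain N) ++ window_program G p) (ground Goal [] (Some tau)).
Proof.
  intros H. destruct (compile_complete G (compile G 1) [p] 1 H (incl_refl _)) as [M HM].
  (* The chain must contain the levels used by the computation, the input [p] and the result 1. *)
  exists (max M (max p 1)).
  set (N := max M (max p 1)). set (P := facts_as_rules (chain N) ++ window_program G p).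
  assert (HL : forall n, n <= N -> entails P (level n n)).
  { intros n Hn. now apply reach_entails, chain_reach. }
  assert (HG : entails P (ground (Ev G) [1; p] None)).
  { eapply entails_cut; [|exact HM]. intros r Hr. apply in_app_or in Hr. destruct Hr as [Hr|Hr].
    - right. apply in_map_iff in Hr. destruct Hr as [n [<- Hn]]. apply in_seq in Hn.
      exists (level n n). split; auto. apply HL. lia.
    - left. apply in_or_app. right; right. apply in_or_app. right. apply in_or_app. right.
      now right. }
  apply goal_everywhere; [apply level_clauses_incl|].
  set (env := fun i : nat => match i with 0 => 1 | _ => p end).
  set (vt := fun i : nat => match i with 0 => 0%Z | _ => Z.of_nat p end).
  apply (entails_clause P (accept_body G) (at_time Goal (TConst 0)) env vt).
  { apply in_or_app. right; right. apply in_or_app. right. apply in_or_app. right. now left. }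
  intros l [<-|[<-|[<-|[<-|[<-|[]]]]]]; unfold lit_ground; cbn; rewrite ?Z.add_0_r.
  - apply (entails_rule P (mkRule [mkAtom tick_pred [] (Some (TVar 0 0))]
             (lit_atom (at_time On (TVar 0 0)))) _ env vt).
    + apply in_or_app. right; right. apply in_or_app. left. cbn; tauto.
    + intros b [<-|[]]. exists (mkAtom tick_pred [] (Some (TConst 0))). split; auto.
      apply entails_fact, (in_or_app (facts_as_rules (chain N))). left. now left.
    + auto.
  - apply entails_fact, (in_or_app (facts_as_rules (chain N))). right. now left.
  - apply HL. lia.
  - exact HG.
  - apply (HL 1). lia.
Qed.

(** With both parameters 0 and [tau_in] equal to 0, the tick at time 0 belongs to the history but is
    forgotten by the window. The full chain entails the goal; without the tick, interpreting each
    constant [n] as [Some n] refutes it. *)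
Lemma window_fails G p : reval G [p] 1 -> ~ Window (window_instance G p).
Proof.
  intros H HW. destruct (chain_goal G p H) as [N HN].
  assert (HD : is_dataset (chain N)).
  { intros a [<-|Ha].
    - repeat split; cbn; try congruence; [now intros ? []|]. intros t [= <-]. eauto.
    - apply in_map_iff in Ha. destruct Ha as [n [<- _]].
      repeat split; cbn; try congruence. intros t [<-|[<-|[]]]; eauto. }
  specialize (HW 0%Z 1%Z ltac:(cbn; lia) (chain N) []).
  assert (Ha : answer (i_query (window_instance G p)) (restrict (chain N) 0 ++ []) 1 []).
  { apply HW.
    - split; auto. intros a [<-|Ha].
      + right. exists 0%Z. split; auto. lia.
      + left. apply in_map_iff in Ha. now destruct Ha as [n [<- _]].
    - split; intros a [].
    - apply goal_answer. rewrite app_nil_r. auto. }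
  apply goal_answer in Ha. destruct Ha as [_ Ha]. revert Ha.
  assert (Hs : forall a, In a (restrict (chain N) 0 ++ []) -> exists n, a = succ_fact n (S n)).
  { intros a Ha. rewrite app_nil_r in Ha. apply filter_In in Ha. destruct Ha as [[<-|Ha] Hk].
    - discriminate Hk.
    - apply in_map_iff in Ha. destruct Ha as [n [<- _]]. eauto. }
  apply (goal_not_entailed G p False Some); auto.
  - tauto.
  - intros a Ha. rewrite app_nil_r in Ha. apply filter_In in Ha. now apply HD.
  - intros a b n Hab [= <-]. apply Hs in Hab. destruct Hab as [m E]. now injection E as -> ->.
  - intros a Ha E. apply Hs in Ha. destruct Ha as [n ->]. discriminate E.
Qed.

(** * Computability of the code of the instance *)

Definition computes (F : recf) (g : nat -> nat) : Prop := forall x, reval F [x] (g x).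

Fixpoint const_recf (k : nat) : recf :=
  match k with 0 => RZero | S k => RComp RSucc [const_recf k] end.

Lemma computes_const k : computes (const_recf k) (fun _ => k).
Proof.
  intros x. induction k; cbn; [constructor|].
  econstructor; [constructor; [eassumption|constructor]|constructor].
Qed.

Lemma computes_succ F g : computes F g -> computes (RComp RSucc [F]) (fun x => S (g x)).
Proof. intros H x. econstructor; [constructor; [apply H|constructor]|constructor]. Qed.

Lemma computes_id : computes (RProj 0) (fun x => x).
Proof. intros x. apply (@ev_proj 0 [x]). cbn; lia. Qed.

Definition add_recf : recf := RPrim (RProj 0) (RComp RSucc [RProj 1]).

Lemma reval_add x y : reval add_recf [x; y] (x + y).
Proof.
  induction x.
  - constructor. apply (@ev_proj 0 [y]). cbn; lia.
  - econstructor; [exact IHx|].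
    econstructor; [constructor; [|constructor]|constructor].
    apply (@ev_proj 1 [x; x + y; y]). cbn; lia.
Qed.

Lemma computes_binary B op F G f g :
  (forall x y, reval B [x; y] (op x y)) -> computes F f -> computes G g ->
  computes (RComp B [F; G]) (fun x => op (f x) (g x)).
Proof.
  intros HB HF HG x. econstructor; [|apply HB].
  constructor; [apply HF|constructor; [apply HG|constructor]].
Qed.

(** [cpair] divides by 2 only to form triangular numbers, which primitive recursion obtains by
    summation. *)
Definition triangle_recf : recf := RPrim RZero (RComp add_recf [RComp RSucc [RProj 0]; RProj 1]).

Lemma reval_triangle n : reval triangle_recf [n] (n * (n + 1) / 2).
Proof.
  induction n as [|n IH].
  - constructor. constructor.
  - replace (S n * (S n + 1) / 2) with (S n + n * (n + 1) / 2).
    + econstructor; [exact IH|]. econstructor; [|apply reval_add].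
      constructor; [|constructor; [|constructor]].
      * econstructor; [constructor; [|constructor]|constructor].
        apply (@ev_proj 0 [n; n * (n + 1) / 2]). cbn; lia.
      * apply (@ev_proj 1 [n; n * (n + 1) / 2]). cbn; lia.
    + rewrite <- Nat.div_add_l by lia. f_equal. lia.
Qed.

Definition cpair_recf : recf :=
  RComp add_recf [RComp triangle_recf [add_recf]; RProj 1].

Lemma reval_cpair x y : reval cpair_recf [x; y] (cpair x y).
Proof.
  econstructor; [|apply reval_add]. constructor; [|constructor; [|constructor]].
  - econstructor; [constructor; [apply reval_add|constructor]|apply reval_triangle].
  - apply (@ev_proj 1 [x; y]). cbn; lia.
Qed.

(** A nonnegative integer is coded by its double, also at 0, so the input enters through one
    addition. *)
Lemma enc_input_rule n :
  enc_rule (input_rule n) =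
  cpair 0 (cpair (enc_pred (sym_pred Inp 0 true)) (cpair 0 (S (cpair 1 (n + n))))).
Proof.
  unfold enc_rule, enc_atom, input_rule, ground.
  cbn [r_body r_head a_pred a_objs a_time enc_list enc_option enc_tterm option_map map length is_some].
  replace (enc_Z (Z.of_nat n)) with (n + n); auto.
  destruct n; [reflexivity|]. cbn [Z.of_nat enc_Z]. rewrite SuccNat2Pos.id_succ. lia.
Qed.

(* The code of [window_instance G p] when [p] is the code of [simulation G], for any [G]. *)
Definition self_encoding (p : nat) : nat :=
  cpair (cpair (enc_pred (sym_pred Goal 0 true)) (S (cpair (enc_rule (input_rule p)) p)))
        (cpair 0 0).

(** The input rule heads the program, so the tail is [simulation G], whose code is [p]. *)
Lemma enc_window_instance G p :
  p = enc_list enc_rule (simulation G) -> enc_instance (window_instance G p) = self_encoding p.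
Proof.
  intros Hp. unfold enc_instance, window_instance, window_program, self_encoding.
  cbn [i_query q_pred q_prog i_d i_s enc_list]. now rewrite <- Hp.
Qed.

Lemma self_encoding_computable : exists E, computes E self_encoding.
Proof.
  pose proof (fun F G f g => computes_binary cpair_recf cpair F G f g reval_cpair) as Hpair.
  pose proof (fun F G f g => computes_binary add_recf Nat.add F G f g reval_add) as Hadd.
  eexists. intros p. unfold self_encoding. rewrite enc_input_rule. revert p.
  refine (Hpair _ _ _ _ (Hpair _ _ _ _ (computes_const _)
    (computes_succ _ _ (Hpair _ _ _ _ _ computes_id)))
    (Hpair _ _ _ _ (computes_const 0) (computes_const 0))).
  refine (Hpair _ _ _ _ (computes_const 0) (Hpair _ _ _ _ (computes_const _)
    (Hpair _ _ _ _ (computes_const 0) (computes_succ _ _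
      (Hpair _ _ _ _ (computes_const 1) (Hadd _ _ _ _ computes_id computes_id)))))).
Qed.

(** * The diagonal argument *)

Theorem theorem11 : ~ decidable_problem Window.
Proof.
  intros [f Hf]. destruct self_encoding_computable as [E HE].
  (* No circularity arises: [simulation G] does not contain the input, so [p] can be chosen after
     [G]. *)
  set (G := RComp f [E]). remember (enc_list enc_rule (simulation G)) as p eqn:Hp.
  specialize (Hf (window_instance G p) (window_instance_is_instance G p)).
  rewrite (enc_window_instance G p Hp) in Hf.
  assert (HG : forall y, reval f [self_encoding p] y -> reval G [p] y).
  { intros y Hy. econstructor; [|exact Hy]. constructor; [apply HE|constructor]. }
  (* If the property holds, the verdict 1 makes [G] return 1 and the property fails; if it fails,
     the verdict 0 excludes the value 1 and the property holds. *)
  destruct (classic (Window (window_instance G p))) as [HW|HW].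
  - apply (window_fails G p); auto. now apply HG, Hf.
  - apply HW, window_holds. intros H1.
    discriminate (reval_functional _ _ _ _ H1 (HG 0 (proj2 Hf HW))).
Qed.
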